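(* Let $k\in\{2,3,4\}$ and let $R$ be a complete intersection SAGA of codimension $n+1$ presented by quadrics. If $n\ge k+1$, then $R$ satisfies $SLP_1(k)$, i.e. for general $x\in R^1$ the multiplication map $x^k\cdot:R^1\to R^{k+1}$ is injective.
   Context: $\mathbb K$ is an algebraically closed field of characteristic $0$. A complete intersection SAGA of codimension $n+1$ presented by quadrics is $R=S/I$, $S=\mathbb K[x_0,\dots,x_n]$, $I$ generated by a regular sequence of $n+1$ homogeneous quadrics (standard graded Artinian Gorenstein, socle degree $n+1$). *)

(* Defs.v *)
From mathcomp Require Import all_boot all_order all_algebra.
From mathcomp Require Import mpoly.
Set Implicit Arguments. Unset Strict Implicit. Unset Printing Implicit Defensive.
Import GRing.Theory.
Local Open Scope ring_scope.

Definition in_ideal_prefix (K : fieldType) (m N : nat)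
  (q : 'I_N -> {mpoly K[m]}) (i : nat) (p : {mpoly K[m]}) : Prop :=
  exists c : 'I_N -> {mpoly K[m]}, p = \sum_(j < N | (j < i)%N) c j * q j.

Definition in_ideal (K : fieldType) (m N : nat)
  (q : 'I_N -> {mpoly K[m]}) (p : {mpoly K[m]}) : Prop :=
  in_ideal_prefix q N p.

Definition regular_sequence (K : fieldType) (m N : nat)
  (q : 'I_N -> {mpoly K[m]}) : Prop :=
  (forall (i : 'I_N) (p : {mpoly K[m]}),
      in_ideal_prefix q i (p * q i) -> in_ideal_prefix q i p)
  /\ ~ in_ideal q 1.

(* The linear form a_0 x_0 + ... + a_{m-1} x_{m-1}, i.e. an element of S_1 = R^1
   (R^1 = S_1 since I is generated in degree 2). *)
Definition linform (K : fieldType) (m : nat) (a : 'I_m -> K) : {mpoly K[m]} :=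
  \sum_(i < m) a i *: 'X_i.

(* Multiplication by (class of) x^k from R^1 to R^{k+1} is injective, where
   R = S/I: for every degree-1 element l of S, x^k l in I implies l in I. *)
Definition mult_pow_injective_R1 (K : fieldType) (m N : nat)
  (q : 'I_N -> {mpoly K[m]}) (x : {mpoly K[m]}) (k : nat) : Prop :=
  forall l : {mpoly K[m]}, l \is 1.-homog ->
    in_ideal q (x ^+ k * l) -> in_ideal q l.

(* Main.v *)
From HB Require Import structures.
Require Import Defs.
From mathcomp Require Import all_boot all_order all_algebra.
From mathcomp Require Import generic_quotient.
From mathcomp Require Import mpoly.
From mathcomp Require Import ring zify.
Set Implicit Arguments. Unset Strict Implicit. Unset Printing Implicit Defensive.
Import GRing.Theory.
Local Open Scope ring_scope.

(* Let L be the fraction field of K[a_0..a_n] and x = sum a_i X_i the generic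
   linear form. If x^k kills some y <> 0 in degree one over L, then
   differentiating the relations x^i y^j = 0 with respect to the a_s and
   multiplying by y gives x^i y^(k+1-i) = 0 for all i. Let T be the span of y
   and its partial derivatives D_s y, and let U be the space of directions v
   with D_v y proportional to y. Then T kills the last nonzero power of y, and
   U kills every x^i y^(k-i) with i < k. The contradiction comes from comparing
   the dimensions of T and U by means of one fact on complete intersections of
   quadrics: a nonzero class of degree d is killed by at most d independent
   linear forms. That fact is Tor_a(S/I, S/(l_1..l_a)) computed from the Koszul
   complex of the quadrics, which is concentrated in internal degrees >= 2a. *)

(** * Truncation and ideals generated by quadrics *)

Section Truncation.
Variables (K : fieldType) (m : nat).
Local Notation S := {mpoly K[m]}.
Implicit Types p q : S.

(** The bound is strict, to match [msize]. Truncating an identity with homogeneous generators bounds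
    the degrees of its coefficients. *)
Definition trunc (D : nat) p : S := \sum_(d < D) pihomog mdeg d p.

Fact trunc_is_linear D : linear (trunc D).
Proof.
move=> c p r; rewrite /trunc scaler_sumr -big_split /=.
by apply: eq_bigr => d _; rewrite linearP.
Qed.

HB.instance Definition _ D :=
  GRing.isLinear.Build K S S _ (trunc D) (trunc_is_linear D).

Lemma trunc0n p : trunc 0 p = 0. Proof. by rewrite /trunc big_ord0. Qed.

Lemma trunc_small D p : (msize p <= D)%N -> trunc D p = p.
Proof. by move=> leD; rewrite [RHS](pihomog_partitionE leD). Qed.

Lemma trunc_homog D t p : p \is t.-homog ->
  trunc D p = if (t < D)%N then p else 0.
Proof.
move=> hp; have E d : pihomog mdeg d p = if d == t then p else 0.
  case: eqP => [->|/eqP ne]; first exact: pihomog_dE.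
  by rewrite (pihomog_ne0 _ hp) // eq_sym.
rewrite /trunc; under eq_bigr do rewrite E.
case: ifP => ltD; first by rewrite -big_mkcond /= (big_pred1 (Ordinal ltD)).
by rewrite big1 // => d _; case: eqP => // Ed; rewrite -Ed ltn_ord in ltD.
Qed.

Lemma msize_homog d p : p \is d.-homog -> (msize p <= d.+1)%N.
Proof.
move=> hp; rewrite msizeE; apply/bigmax_leqP_seq => t tp _.
by rewrite ltnS (dhomog_mf hp tp).
Qed.

Lemma trunc_id D p : trunc D (trunc D p) = trunc D p.
Proof.
rewrite {2 3}/trunc raddf_sum; apply: eq_bigr => d _.
by rewrite /= (trunc_homog _ (pihomogP _ _ _)) ltn_ord.
Qed.

(** If [D - e] saturates at 0, both sides vanish, since [q * p] starts in degree [e]. *)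
Lemma truncM D e q p : q \is e.-homog -> trunc D (q * p) = q * trunc (D - e) p.
Proof.
move=> hq; rewrite {1 2}(pihomog_partitionE (leqnn (msize p))).
rewrite mulr_sumr !raddf_sum mulr_sumr /=; apply: eq_bigr => i _.
have hp := pihomogP mdeg i p.
rewrite (trunc_homog _ hp) (trunc_homog _ (dhomogM hq hp)).
by rewrite -ltn_subRL; case: ifP => //; rewrite mulr0.
Qed.

End Truncation.

Section PrefixIdeal.
Variables (K : fieldType) (m N : nat) (q : 'I_N -> {mpoly K[m]}).
Local Notation S := {mpoly K[m]}.
Implicit Types p r : S.

Lemma ideal_prefix0 i : in_ideal_prefix q i 0.
Proof. by exists (fun=> 0); rewrite big1 // => j _; rewrite mul0r. Qed.

Lemma ideal_prefixD i p r :
  in_ideal_prefix q i p -> in_ideal_prefix q i r -> in_ideal_prefix q i (p + r).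
Proof.
case=> c -> [d ->]; exists (fun j => c j + d j); rewrite -big_split /=.
by apply: eq_bigr => j _; rewrite mulrDl.
Qed.

Lemma ideal_prefixMl i r p :
  in_ideal_prefix q i p -> in_ideal_prefix q i (r * p).
Proof.
case=> c ->; exists (fun j => r * c j); rewrite mulr_sumr.
by apply: eq_bigr => j _; rewrite mulrA.
Qed.

Lemma ideal_prefixN i p : in_ideal_prefix q i p -> in_ideal_prefix q i (- p).
Proof. by rewrite -mulN1r; apply: ideal_prefixMl. Qed.

Lemma ideal_prefixB i p r :
  in_ideal_prefix q i p -> in_ideal_prefix q i r -> in_ideal_prefix q i (p - r).
Proof. by move=> hp /ideal_prefixN; apply: ideal_prefixD. Qed.

Lemma ideal_prefixZ i (c : K) p :
  in_ideal_prefix q i p -> in_ideal_prefix q i (c *: p).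
Proof. by rewrite -mul_mpolyC; apply: ideal_prefixMl. Qed.

Lemma ideal_prefix_sum i (I : Type) (s : seq I) (F : I -> S) :
  (forall j, in_ideal_prefix q i (F j)) ->
  in_ideal_prefix q i (\sum_(j <- s) F j).
Proof.
move=> hF; elim/big_rec: _ => [|j p _ hp]; first exact: ideal_prefix0.
exact: ideal_prefixD.
Qed.

Lemma ideal_prefix0_eq0 p : in_ideal_prefix q 0 p -> p = 0.
Proof. by case=> c ->; rewrite big_pred0. Qed.

Lemma ideal_prefixSP (i : 'I_N) p :
  in_ideal_prefix q i.+1 p <-> exists c, in_ideal_prefix q i (p - q i * c).
Proof.
split=> [[c ->]|[b [c E]]].
  exists (c i), c; rewrite (bigD1 i) ?leqnn //= mulrC addrC addrK.
  by apply: eq_bigl => j; rewrite ltnS ltn_neqAle andbC.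
exists (fun j => if j == i then b else c j).
rewrite (bigD1 i) ?leqnn //= eqxx -[LHS](subrK (q i * b)) E addrC mulrC.
congr (_ + _); apply: eq_big => [j|j ltji].
  by rewrite ltnS [RHS]andbC -ltn_neqAle.
by rewrite -val_eqE /= ltn_eqF.
Qed.

Lemma in_ideal_gen j : in_ideal q (q j).
Proof.
exists (fun i => (i == j)%:R); rewrite (bigD1 j) ?ltn_ord //= eqxx mul1r.
by rewrite big1 ?addr0 // => i /andP[_ /negPf ->]; rewrite mul0r.
Qed.

Hypothesis hq : forall i, q i \is 2.-homog.

Lemma ideal_prefix_trunc i D p :
  in_ideal_prefix q i p -> in_ideal_prefix q i (trunc D p).
Proof.
case=> c ->; exists (fun j => trunc (D - 2) (c j)); rewrite raddf_sum /=.
by apply: eq_bigr => j _; rewrite ![_ * q j]mulrC (truncM _ _ (hq j)).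
Qed.

(** Truncating the relation below degree 2 leaves no room for the quadrics. *)
Lemma in_ideal_msize p : (msize p <= 2)%N -> in_ideal q p -> p = 0.
Proof.
move=> sp [c Ep]; rewrite -(trunc_small sp) Ep raddf_sum big1 // => j _.
have E := truncM 2 (c j) (hq j).
by rewrite /= mulrC E trunc0n mulr0.
Qed.

End PrefixIdeal.

(** * Koszul complexes *)

Section Koszul.
Variable R : idomainType.

(* Adding a linear form takes the mapping cone of multiplication by it, so a
   cochain for [a] forms is an iterated pair and no signs or exterior powers occur. *)
Fixpoint koszul (a : nat) : lmodType R :=
  if a is a'.+1 then GRing.Lmodule.clone R (koszul a' * koszul a')%type _
  else GRing.Lmodule.clone R R^o _.
(** In a pair the first component is free of the last exterior generator and the second is its
    coefficient. The minus sign of the mapping cone gives [kd_kd]. *)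
Fixpoint kd (l : nat -> R) a : koszul a -> koszul a :=
  if a is a'.+1 return koszul a -> koszul a then
    fun z => (kd l z.1, l a' *: z.1 - kd l z.2)
  else fun=> 0.

(** Inclusion of the top cochain degree; [kbot] is that of cochain degree 0. *)
Fixpoint ktop a : R -> koszul a :=
  if a is a'.+1 return R -> koszul a then fun s => (0, ktop a' s)
  else fun s => s.

Fixpoint kbot a : R -> koszul a :=
  if a is a'.+1 return R -> koszul a then fun s => (kbot a' s, 0)
  else fun s => s.

Fixpoint kmap (f : R -> R) a : koszul a -> koszul a :=
  if a is a'.+1 return koszul a -> koszul a then
    fun z => (kmap f z.1, kmap f z.2)
  else f.

Fixpoint kall (I : R -> Prop) a : koszul a -> Prop :=
  if a is a'.+1 return koszul a -> Prop then
    fun z => kall I z.1 /\ kall I z.2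
  else I.

Fact kd_linear l a : linear (@kd l a).
Proof.
elim: a => [|a IH] c u v; first by rewrite /= scaler0 addr0.
rewrite /= !IH; congr (_, _) => /=.
by rewrite scalerDr opprD !scalerA mulrC scalerBr !scalerA addrACA.
Qed.
HB.instance Definition _ l a :=
  GRing.isLinear.Build R (koszul a) (koszul a) _ (@kd l a) (@kd_linear l a).

Lemma kdZ l a c (z : koszul a) : kd l (c *: z) = c *: kd l z.
Proof. by have := kd_linear l c z 0; rewrite raddf0 !addr0. Qed.

Lemma kdB l a (z w : koszul a) : kd l (z - w) = kd l z - kd l w.
Proof. exact: (raddfB (@kd l a)). Qed.

Fact ktop_linear a : linear (@ktop a : R^o -> koszul a).
Proof.
elim: a => [|a IH] c u v //=.
by rewrite IH; congr (_, _); rewrite /= ?scaler0 ?addr0.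
Qed.
HB.instance Definition _ a :=
  GRing.isLinear.Build R R^o (koszul a) _ (@ktop a) (@ktop_linear a).

Lemma ktopZ a c s : ktop a (c * s) = c *: ktop a s.
Proof. by have := @ktop_linear a c s 0; rewrite raddf0 !addr0. Qed.

Lemma kd_ktop l a s : kd l (ktop a s) = 0.
Proof.
by elim: a => [|a IH] //=; rewrite IH raddf0 scaler0 subr0.
Qed.

Lemma kd_kd l a (z : koszul a) : kd l (kd l z) = 0.
Proof.
elim: a z => [|a IH] z //=; rewrite IH; congr (_, _).
by rewrite kdB kdZ IH subr0 subrr.
Qed.

(** One half of the identification of the top cohomology with the quotient of R by the forms. *)
Lemma ktop_coboundary (l : nat -> R) a (c : nat -> R) :
  exists e, ktop a (\sum_(b < a) c b * l b) = kd l e.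
Proof.
elim: a => [|a [e IH]]; first by exists 0; rewrite raddf0 big_ord0.
exists (ktop a (c a), - e); rewrite big_ord_recr /= kd_ktop; congr (_, _).
rewrite raddfN opprK raddfD /= IH addrC; congr (_ + _).
by rewrite mulrC ktopZ.
Qed.

Lemma kmap_kd (f : {rmorphism R -> R}) l a (z : koszul a) :
  (forall b, (b < a)%N -> f (l b) = 0) -> kmap f (kd l z) = 0.
Proof.
have f0 a' : kmap f (0 : koszul a') = 0.
  by elim: a' => [|a' IH] /=; rewrite ?IH ?rmorph0.
have fB a' (u v : koszul a') : kmap f (u - v) = kmap f u - kmap f v.
  by elim: a' u v => [|a' IH] u v /=; rewrite ?IH ?rmorphB.
have fZ a' c (u : koszul a') : kmap f (c *: u) = f c *: kmap f u.
  by elim: a' u => [|a' IH] u /=; rewrite ?IH ?rmorphM.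
elim: a z => [|a IH] z fl /=; first exact: rmorph0.
have fl' b : (b < a)%N -> f (l b) = 0 by move=> ?; apply/fl/ltnW.
by rewrite fB fZ !IH // fl // scale0r subr0.
Qed.

Lemma kmap_ktop (f : {rmorphism R -> R}) a s :
  kmap f (ktop a s) = 0 -> f s = 0.
Proof. by elim: a => [|a IH] //= [_ /IH]. Qed.

(** Regularity without quotient rings: the kernel of [f] is exactly the ideal of the earlier forms,
    so the quotient by it embeds through [f] into the domain R, where [l b] has nonzero image. *)
Definition linear_regular (l : nat -> R) (a : nat) :=
  forall b, (b < a)%N -> exists f : {rmorphism R -> R},
    [/\ forall c, (c < b)%N -> f (l c) = 0, f (l b) != 0 &
        forall s, exists c : nat -> R, s - f s = \sum_(i < b) c i * l i].

(** Exactness outside top degree, by induction on the mapping cone. A cocycle (u, v) has u closed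
    and [l a *: u = kd l v]; regularity of [l a] removes the top part of u, and correcting v by a
    primitive of u leaves a cocycle of the smaller complex. *)
Lemma koszul_exact l a (z : koszul a) : linear_regular l a ->
  kd l z = 0 -> exists e s, z = kd l e + ktop a s.
Proof.
elim: a z => [|a IH] z reg; first by move=> _; exists 0, z; rewrite raddf0 add0r.
have reg' : linear_regular l a by move=> b ltb; apply/reg/ltnW.
case: z => u v; rewrite /= => -[du0 duv].
have {}duv : l a *: u = kd l v by apply/eqP; rewrite -subr_eq0 duv.
have [e Eu] : exists e, u = kd l e.
  have [e [s Eu]] := IH u reg' du0.
  have [f [fl fla fs]] := reg a (leqnn _).
  suff fs0 : f s = 0.
    have [c Ec] := fs s; rewrite fs0 subr0 in Ec.
    have [e' Ee'] := ktop_coboundary l a c.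
    by exists (e + e'); rewrite raddfD /= -Ee' -Ec.
  (* The top class of [l a * s] is a coboundary, so its coefficients die under [f]; as [f (l a)] is
     nonzero in a domain, [f s] is 0. *)
  have Et : ktop a (l a * s) = kd l (v - l a *: e).
    by rewrite kdB -duv kdZ -scalerBr Eu addrC addKr -ktopZ.
  have := congr1 (@kmap f a) Et; rewrite (kmap_kd _ fl) => /kmap_ktop /eqP.
  by rewrite rmorphM mulf_eq0 (negPf fla) => /eqP.
have [|f [s Ef]] := IH (v - l a *: e) reg'.
  by rewrite kdB kdZ -duv Eu subrr.
exists (e, - f), s => /=; rewrite Eu; congr (_, _); rewrite ?addr0 //.
by rewrite raddfN opprK -addrA -Ef addrC subrK.
Qed.

End Koszul.

(** * Degrees in the Koszul complex and reduction modulo the quadrics *)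

Section KoszulGrading.
Variables (K : fieldType) (m : nat).
Local Notation S := {mpoly K[m]}.
Local Notation koszul := (koszul S).

(* The part of cochain degree [P - 1] with coefficients of degree below [J];
   [P = 0] stands for the zero space in degree -1. *)
Fixpoint kproj P J a : koszul a -> koszul a :=
  if a is a'.+1 return koszul a -> koszul a then
    fun z => (kproj P J z.1, kproj P.-1 J z.2)
  else fun s => if P == 1 then trunc J s else 0.

Fact kproj_additive P J a : zmod_morphism (@kproj P J a).
Proof.
elim: a P => [|a IH] P u v /=; last by rewrite !IH.
by case: ifP => _; rewrite ?raddfB ?subr0.
Qed.
HB.instance Definition _ P J a := GRing.isZmodMorphism.Build
  (koszul a) (koszul a) (@kproj P J a) (@kproj_additive P J a).

Lemma kproj0n J a (z : koszul a) : kproj 0 J z = 0.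
Proof. by elim: a z => [|a IH] z //=; rewrite !IH. Qed.

Lemma kprojn0 P a (z : koszul a) : kproj P 0 z = 0.
Proof.
elim: a P z => [|a IH] P z /=; last by rewrite !IH.
by case: ifP; rewrite ?trunc0n.
Qed.

Lemma kprojZ P J e (q : S) a (z : koszul a) : q \is e.-homog ->
  kproj P J (q *: z) = q *: kproj P (J - e) z.
Proof.
move=> hq; elim: a P z => [|a IH] P z /=; last by rewrite !IH.
by case: ifP; rewrite ?scaler0 // => _; apply: truncM.
Qed.

Lemma kproj_id P J a (z : koszul a) : kproj P J (kproj P J z) = kproj P J z.
Proof.
elim: a P z => [|a IH] P z /=; last by rewrite !IH.
by case: (P == 1) => //; apply: trunc_id.
Qed.

Lemma kproj1_kd l J a (z : koszul a) : kproj 1 J (kd l z) = 0.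
Proof.
by elim: a z => [|a IH] z /=; rewrite ?raddf0 // IH kproj0n.
Qed.

Lemma kproj_ktop P J a s : (P <= a)%N -> kproj P J (ktop a s) = 0.
Proof.
elim: a P => [|a IH] P; first by rewrite leqn0 => /eqP ->.
move=> leP /=; rewrite raddf0 IH //.
case: P leP => //= P; rewrite ltnS. 
Qed.

Lemma kproj_kbot J a s : kproj 1 J (kbot a s) = kbot a (trunc J s).
Proof. by elim: a => [|a IH] //=; rewrite IH raddf0. Qed.

(** The differential raises both cochain degree and coefficient degree by one. *)
Lemma kd_kproj l P J a (z : koszul a) : (forall b, (b < a)%N -> l b \is 1.-homog) ->
  kproj P.+1 J.+1 (kd l z) = kd l (kproj P J z).
Proof.
elim: a P z => [|a IH] P z hl /=; first by case: ifP; rewrite ?raddf0.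
have hl' b : (b < a)%N -> l b \is 1.-homog by move=> ?; apply/hl/ltnW.
rewrite IH //; congr (_, _); rewrite raddfB /= (kprojZ _ _ _ (hl a _)) // subn1.
congr (_ - _); case: P => [|P] /=; last exact: IH.
by rewrite !kproj0n raddf0.
Qed.

Section KallIdeal.
Variables (N : nat) (q : 'I_N -> S) (i : nat).
Local Notation kin := (kall (in_ideal_prefix q i)).

Lemma kallB a (z w : koszul a) : kin z -> kin w -> kin (z - w).
Proof.
elim: a z w => [|a IH] z w /=; first exact: ideal_prefixB.
by case=> ? ? [? ?]; split; apply: IH.
Qed.

Lemma kallN a (z : koszul a) : kin z -> kin (- z).
Proof.
elim: a z => [|a IH] z /=; first exact: ideal_prefixN.
by case=> ? ?; split; apply: IH.
Qed.

Lemma kallD a (z w : koszul a) : kin z -> kin w -> kin (z + w).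
Proof. by move=> hz hw; rewrite -[w]opprK; apply/kallB/kallN. Qed.

Lemma kallZ a c (z : koszul a) : kin z -> kin (c *: z).
Proof.
elim: a z => [|a IH] z /=; first exact: ideal_prefixMl.
by case=> ? ?; split; apply: IH.
Qed.

Lemma kall0 a : kin (0 : koszul a).
Proof. by elim: a => [|a IH] //=; apply: ideal_prefix0. Qed.

Lemma kall_kd l a (z : koszul a) : kin z -> kin (kd l z).
Proof.
elim: a z => [|a IH] z /=; first by move=> _; apply: ideal_prefix0.
by case=> h1 h2; split; [apply: IH | apply: kallB; [apply: kallZ | apply: IH]].
Qed.

Lemma kall_kbot a s : kin (kbot a s) -> in_ideal_prefix q i s.
Proof. by elim: a => [|a IH] //= [/IH]. Qed.

Lemma kall_kd_kbot l a s :
  (forall b, (b < a)%N -> in_ideal_prefix q i (l b * s)) -> kin (kd l (kbot a s)).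
Proof.
elim: a => [|a IH] hl /=; first exact: ideal_prefix0.
split; first by apply: IH => b ltb; apply/hl/ltnW.
rewrite raddf0 subr0.
have {hl IH}: in_ideal_prefix q i (l a * s) by apply: hl.
elim: a (l a) => [|a IH] c //= h; rewrite scaler0.
by split; [apply: IH | apply: kall0].
Qed.

Hypothesis hq : forall j, q j \is 2.-homog.

Lemma kall_kproj P J a (z : koszul a) : kin z -> kin (kproj P J z).
Proof.
elim: a P z => [|a IH] P z /=.
  by case: ifP => _; [apply: ideal_prefix_trunc | move=> _; apply: ideal_prefix0].
by case=> h1 h2; split; apply: IH.
Qed.

End KallIdeal.

Lemma kall_prefix0 N (q : 'I_N -> S) a (z : koszul a) :
  kall (in_ideal_prefix q 0) z -> z = 0.
Proof.
elim: a z => [|a IH] z /=; first exact: ideal_prefix0_eq0.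
by case: z => u v /= [/IH -> /IH ->].
Qed.

Lemma kall_prefixS N (q : 'I_N -> S) (i : 'I_N) a (z : koszul a) :
  kall (in_ideal_prefix q i.+1) z ->
  exists c, kall (in_ideal_prefix q i) (z - q i *: c).
Proof.
elim: a z => [|a IH] z /=; first by move/ideal_prefixSP.
by case=> /IH[c1 h1] /IH[c2 h2]; exists (c1, c2).
Qed.

Lemma kall_prefix_widen N (q : 'I_N -> S) (i : 'I_N) a (z : koszul a) :
  kall (in_ideal_prefix q i) z -> kall (in_ideal_prefix q i.+1) z.
Proof.
elim: a z => [|a IH] z /=; last by case=> /IH ? /IH ?.
by move=> h; apply/ideal_prefixSP; exists 0; rewrite mulr0 subr0.
Qed.

Lemma kall_prefix_gen N (q : 'I_N -> S) (i : 'I_N) a (z : koszul a) :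
  kall (in_ideal_prefix q i.+1) (q i *: z).
Proof.
elim: a z => [|a IH] z /=; last by split; apply: IH.
apply/ideal_prefixSP; exists z; rewrite subrr; exact: ideal_prefix0.
Qed.

Lemma kall_regular N (q : 'I_N -> S) (i : 'I_N) a (z : koszul a) :
  (forall p, in_ideal_prefix q i (p * q i) -> in_ideal_prefix q i p) ->
  kall (in_ideal_prefix q i) (q i *: z) -> kall (in_ideal_prefix q i) z.
Proof.
move=> reg; elim: a z => [|a IH] z /=; last by case=> /IH ? /IH ?.
by move=> h; apply: reg; rewrite mulrC.
Qed.

(* Balancing of Tor: the regular sequence [q] of quadrics lowers the internal
   degree by one for each cochain degree, so below the diagonal the cohomology of
   the linear forms [l] on S/(q) is that on S. *)
Lemma koszul_exact_quadrics N (q : 'I_N -> S) (l : nat -> S) a i P J (z : koszul a) :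
  (forall j, q j \is 2.-homog) ->
  (forall (j : 'I_N) p, in_ideal_prefix q j (p * q j) -> in_ideal_prefix q j p) ->
  (forall b, (b < a)%N -> l b \is 1.-homog) -> linear_regular l a ->
  (i <= N)%N -> (J + P <= a.+1)%N -> kproj P J z = z ->
  kall (in_ideal_prefix q i) (kd l z) ->
  exists e, kall (in_ideal_prefix q i) (z - kd l e).
Proof.
move=> hq reg hl regl.
elim: i P J z => [|i IH] P J z lei leJP Ez hz.
  (* With no quadrics this is [koszul_exact]: the top summand has index P = a+1, beyond the bound,
     so the projection removes it. *)
  have dz0 := kall_prefix0 hz; case: J Ez leJP => [|J] Ez leJP.
    by exists 0; rewrite -Ez kprojn0 raddf0 subr0; apply: kall0.
  have [e [s Es]] := koszul_exact regl dz0.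
  case: P Ez leJP => [|P] Ez leJP.
    by exists 0; rewrite -Ez kproj0n raddf0 subr0; apply: kall0.
  exists (kproj P J e).
  rewrite -kd_kproj // -Ez Es raddfD /= kproj_ktop; last by lia.
  rewrite addr0 subrr; exact: kall0.
(* Write dz = q_i c modulo the shorter prefix. Regularity makes c a cocycle there, induction gives c
   = df, and z - q_i f is again a cocycle to which induction applies. *)
pose i0 := Ordinal lei; have lei' := ltnW lei.
have [c hc] := kall_prefixS (i := i0) hz.
suff [e he] : exists e : koszul a * koszul a,
    kall (in_ideal_prefix q i) (z - q i0 *: e.1 - kd l e.2).
  exists e.2; rewrite -[z](subrK (q i0 *: e.1)) addrAC; apply: kallD.
    exact: (@kall_prefix_widen _ _ i0).
  exact: (@kall_prefix_gen _ _ i0).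
case: J Ez leJP => [|J] Ez leJP.
  by exists (0, 0); rewrite /= scaler0 -Ez kprojn0 !raddf0 !addr0; apply: kall0.
have Ed : kproj P.+1 J.+2 (kd l z) = kd l z by rewrite kd_kproj // Ez.
(* The differential adds one to each index and the quadric takes two off the coefficients, so (P, J)
   becomes (P+1, J-1) and the sum bounded in the induction is unchanged. *)
have {c hc} [c Ec hc] : exists2 c, kproj P.+1 J c = c &
    kall (in_ideal_prefix q i) (kd l z - q i0 *: c).
  exists (kproj P.+1 J c); first exact: kproj_id.
  have := kall_kproj hq P.+1 J.+2 hc; rewrite raddfB /= Ed.
  by rewrite (kprojZ _ _ _ (hq i0)) !subSS subn0.
have hdc : kall (in_ideal_prefix q i) (kd l c).
  apply: (@kall_regular _ _ i0) (reg i0) _.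
  by have := kall_kd l hc; rewrite raddfB /= kd_kd sub0r kdZ => /kallN; rewrite opprK.
have [e' he'] := IH P.+1 J c lei' ltac:(lia) Ec hdc.
(* If c has no room for coefficients it is 0, and z is already a cocycle modulo the shorter
   prefix. *)
case: J Ez Ed Ec hc leJP => [|J] Ez Ed Ec hc leJP.
  have [|e he] := IH P 1 z lei' ltac:(lia) Ez.
    by move: hc; rewrite -Ec kprojn0 scaler0 subr0.
  by exists (0, e); rewrite /= scaler0 subr0.
pose f := kproj P J e'.
have hf : kall (in_ideal_prefix q i) (c - kd l f).
  by have := kall_kproj hq P.+1 J.+1 he'; rewrite raddfB /= Ec kd_kproj.
have [||e he] := IH P J.+2 (z - q i0 *: f) lei' leJP.
- by rewrite raddfB /= Ez (kprojZ _ _ _ (hq i0)) !subSS subn0 kproj_id.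
- rewrite kdB kdZ -[kd l z](subrK (q i0 *: c)) -addrA -scalerBr.
  by apply: kallD => //; apply: kallZ.
by exists (f, e).
Qed.

(** In cochain degree 0, [z] is a cocycle modulo the quadrics, and P = 1, J = a just meets the bound
    of [koszul_exact_quadrics]. Cochain degree 0 contains no nonzero coboundary. *)
Lemma linear_annihilator N (q : 'I_N -> S) (l : nat -> S) a z :
  (forall j, q j \is 2.-homog) ->
  (forall (j : 'I_N) p, in_ideal_prefix q j (p * q j) -> in_ideal_prefix q j p) ->
  (forall b, (b < a)%N -> l b \is 1.-homog) -> linear_regular l a ->
  (msize z <= a)%N -> (forall b, (b < a)%N -> in_ideal q (l b * z)) ->
  in_ideal q z.
Proof.
move=> hq reg hl regl sz hz.
have Ez : kproj 1 a (kbot a z) = kbot a z by rewrite kproj_kbot trunc_small.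
have [|e he] := koszul_exact_quadrics hq reg hl regl (leqnn N) _ Ez (kall_kd_kbot hz).
  by rewrite addn1.
have := kall_kproj hq 1 a he.
by rewrite raddfB /= Ez kproj1_kd subr0; apply: kall_kbot.
Qed.

End KoszulGrading.

(** * Annihilators in degree one *)

Section LinearForms.
Variables (K : fieldType) (m : nat).
Local Notation S := {mpoly K[m]}.

Definition rowform (u : 'rV[K]_m) : S := linform (fun i => u 0 i).

Fact rowform_is_linear : linear rowform.
Proof.
move=> c u v; rewrite /rowform /linform scaler_sumr -big_split /=.
by apply: eq_bigr => i _; rewrite !mxE scalerDl scalerA.
Qed.
HB.instance Definition _ :=
  GRing.isLinear.Build K 'rV[K]_m S _ rowform rowform_is_linear.

Lemma linform_homog (a : 'I_m -> K) : linform a \is 1.-homog.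
Proof.
by apply: rpred_sum => i _; apply: dhomogZ; rewrite dhomogX /= mdeg1.
Qed.

Lemma rowform_homog u : rowform u \is 1.-homog.
Proof. exact: linform_homog. Qed.

Lemma mcoeff_linform (a : 'I_m -> K) i : (linform a)@_U_(i) = a i.
Proof.
rewrite /linform raddf_sum (bigD1 i) //= mcoeffZ mcoeffX eqxx mulr1.
rewrite big1 ?addr0 // => j ne; rewrite mcoeffZ mcoeffX.
by rewrite eq_mnm1 (negPf ne) mulr0.
Qed.

Lemma rowform_eq0 u : (rowform u == 0) = (u == 0).
Proof.
apply/eqP/eqP => [E|->]; last exact: raddf0.
apply/rowP => i; rewrite mxE -(mcoeff_linform (fun i => u 0 i)).
by rewrite [linform _]E mcoeff0.
Qed.

Lemma rowform_delta i : rowform (delta_mx 0 i) = 'X_i.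
Proof.
rewrite /rowform /linform (bigD1 i) //= mxE !eqxx scale1r big1 ?addr0 // => j ne.
by rewrite mxE (negPf ne) andbF scale0r.
Qed.

Lemma homog1_rowform (p : S) : p \is 1.-homog -> p = rowform (\row_i p@_U_(i)).
Proof.
move=> hp; apply/mpolyP => t.
have [/mdeg1P[i /eqP ->]|ne] := boolP (mdeg t == 1).
  by rewrite (mcoeff_linform (fun i => _)) mxE.
by rewrite !(dhomog_nemf_coeff _ ne) // rowform_homog.
Qed.

(** The substitution of linear forms given by [P]. If it is congruent to the identity on linear
    forms modulo an ideal [I], it is so on all polynomials, which are built from the variables. *)
Lemma linear_substitution (P : 'M[K]_m) : exists f : {rmorphism S -> S},
  (forall u, f (rowform u) = rowform (u *m P)) /\
  (forall I : S -> Prop, (forall p r : S, I p -> I r -> I (p + r)) ->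
     (forall p r : S, I p -> I (r * p)) ->
     (forall u, I (rowform (u - u *m P))) -> forall s, I (s - f s)).
Proof.
pose h := [tuple rowform (row i P) | i < m].
have [f fE] : exists f : {rmorphism S -> S}, f =1 comp_mpoly h by exists (comp_mpoly h).
have fX i : f 'X_i = rowform (row i P).
  by rewrite fE comp_mpolyXU -tnth_nth tnth_mktuple.
have fZ c p : f (c *: p) = c *: f p by rewrite !fE comp_mpolyZ.
exists f; split=> [u|I ID IM IX s].
  rewrite {1}/rowform /linform raddf_sum mulmx_sum_row raddf_sum.
  by apply: eq_bigr => i _; rewrite /= fZ fX linearZ.
have I0 : I 0.
  have /(IM _ 0) := IX 0; by rewrite mul0r.
have IMM (p r : S) : I (p - f p) -> I (r - f r) -> I (p * r - f (p * r)).
  move=> Ip Ir; rewrite rmorphM /=.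
  rewrite (_ : _ - _ = p * (r - f r) + f r * (p - f p)); last by ring.
  by apply: ID; apply: IM.
have IXi i : I ('X_i - f 'X_i).
  by have := IX (delta_mx 0 i); rewrite raddfB /= rowform_delta -rowE -fX.
rewrite [s]mpolyE; elim/big_rec: _ => [|t p _ Ip]; first by rewrite raddf0 subr0.
rewrite rmorphD opprD addrACA; apply: ID => //.
rewrite fZ -scalerBr -mul_mpolyC; apply: IM.
rewrite mpolyXE_id; elim/big_rec: _ => [|i r _ Ir]; first by rewrite rmorph1 subrr.
apply: (IMM) => //; elim: (t i) => [|d IH]; first by rewrite !expr0 rmorph1 subrr.
by rewrite exprS; apply: IMM.
Qed.

(** Indexed by [nat], as [kd] requires, with value 0 past the last row. *)
Definition rowforms r (A : 'M[K]_(r, m)) (b : nat) : S :=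
  if insub b is Some i then rowform (row i A) else 0.

Lemma rowformsE r (A : 'M[K]_(r, m)) (i : 'I_r) : rowforms A i = rowform (row i A).
Proof. by rewrite /rowforms valK. Qed.

Lemma rowforms_regular r (A : 'M[K]_(r, m)) :
  row_free A -> linear_regular (rowforms A) r.
Proof.
move=> /row_freeP[Ai AAi] b ltb; pose d := \row_(i < r) (i < b)%N%:R : 'rV[K]_r.
(* Q fixes the first [b] rows of A and kills the others, so substituting by 1 - Q sets the first [b]
   forms to 0 and keeps the rest. *)
pose Q := Ai *m diag_mx d *m A.
have Ad w : w *m diag_mx d *m A = \sum_(i < r | (i < b)%N) w 0 i *: row i A.
  rewrite mulmx_sum_row [RHS]big_mkcond; apply: eq_bigr => i _.
  by rewrite mul_mx_diag !mxE; case: ifP; rewrite ?mulr1 // mulr0 scale0r.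
have AQ i : row i A *m (1%:M - Q) = if (i < b)%N then 0 else row i A.
  rewrite {1}rowE mulmxBr mulmx1 /Q !mulmxA -[_ *m A *m Ai]mulmxA AAi mulmx1 Ad -rowE.
  rewrite big_mkcond (bigD1 i) //= mxE !eqxx scale1r big1 => [|j ne].
    by case: ifP => _; rewrite addr0 ?subrr ?subr0.
  by rewrite mxE (negPf ne) andbF scale0r if_same.
have [f [fE fI]] := linear_substitution (1%:M - Q).
exists f; split=> [c ltc||s].
- have ltcr := ltn_trans ltc ltb.
  by rewrite (rowformsE A (Ordinal ltcr)) fE AQ /= ltc raddf0.
- rewrite (rowformsE A (Ordinal ltb)) fE AQ /= ltnn rowform_eq0.
  apply/eqP => A0.
  have := congr1 (fun M : 'M_r => M (Ordinal ltb) (Ordinal ltb)) AAi.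
  rewrite mxE mxE eqxx big1 => [/eqP|j _]; first by rewrite eq_sym oner_eq0.
  by have := congr1 (fun M : 'rV_m => M 0 j) A0; rewrite !mxE => ->; rewrite mul0r.
apply: (fI (fun s => exists c : nat -> S, s = \sum_(i < b) c i * rowforms A i)).
- move=> _ _ [c ->] [c' ->]; exists (fun i => c i + c' i).
  by rewrite -big_split; apply: eq_bigr => i _; rewrite mulrDl.
- move=> _ p [c ->]; exists (fun i => p * c i).
  by rewrite mulr_sumr; apply: eq_bigr => i _; rewrite mulrA.
move=> u; pose w := u *m Ai.
pose c i : S := if insub i is Some j then (w 0 j)%:MP else 0.
exists c; rewrite (big_ord_widen r (fun i => c i * rowforms A i) (ltnW ltb)).
rewrite mulmxBr mulmx1 opprB addrC subrK /Q !mulmxA Ad raddf_sum /=.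
apply: eq_bigr => i _; rewrite /c valK rowformsE mul_mpolyC.
exact: linearZ.
Qed.

End LinearForms.

Section Annihilators.
Variables (K : fieldType) (m : nat) (q : 'I_m -> {mpoly K[m]}).
Hypothesis hq : forall i, q i \is 2.-homog.
Hypothesis reg : forall (i : 'I_m) (p : {mpoly K[m]}),
  in_ideal_prefix q i (p * q i) -> in_ideal_prefix q i p.

(** Quantifying over the row space makes this a property of the subspace, not of the matrix. *)
Definition annihilates r (A : 'M[K]_(r, m)) (z : {mpoly K[m]}) : Prop :=
  forall u : 'rV_m, (u <= A)%MS -> in_ideal q (rowform u * z).

Lemma annihilates_sub r s (A : 'M[K]_(r, m)) (B : 'M_(s, m)) z :
  (A <= B)%MS -> annihilates B z -> annihilates A z.
Proof. by move=> sAB hB u uA; apply/hB/(submx_trans uA). Qed.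

Lemma annihilatesD r s (A : 'M[K]_(r, m)) (B : 'M_(s, m)) z :
  annihilates A z -> annihilates B z -> annihilates (A + B)%MS z.
Proof.
move=> hA hB u /sub_addsmxP[[x y] ->] /=; rewrite raddfD mulrDl.
by apply: ideal_prefixD; [apply/hA/submxMl | apply/hB/submxMl].
Qed.

Lemma annihilates_rows r (A : 'M[K]_(r, m)) z :
  (forall i, in_ideal q (rowform (row i A) * z)) -> annihilates A z.
Proof.
move=> hA u /submxP[w ->]; rewrite mulmx_sum_row raddf_sum mulr_suml.
apply: ideal_prefix_sum => i; rewrite /= linearZ -scalerAl.
by apply: ideal_prefixZ; apply: hA.
Qed.

(** The basis of every dimension count below: [linear_annihilator] applied to a basis of the row
    space. *)
Lemma annihilator_rank r (A : 'M[K]_(r, m)) z d :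
  z \is d.-homog -> annihilates A z -> (d < \rank A)%N -> in_ideal q z.
Proof.
move=> hz hA ltd.
have sz : (msize z <= \rank A)%N := leq_trans (msize_homog hz) ltd.
apply: (linear_annihilator hq reg _ (rowforms_regular (row_base_free A)) sz).
  move=> b ltb; rewrite (rowformsE (row_base A) (Ordinal ltb)).
  exact: rowform_homog.
move=> b ltb; rewrite (rowformsE (row_base A) (Ordinal ltb)).
by apply: hA; rewrite (submx_trans (row_sub _ _)) // eq_row_base.
Qed.

End Annihilators.

(** * Generic kernels of powers *)

(** Here [xi], [xS], [yj], [yp] stand for x^i, x^(i+1), y^j, y^(j-1). The hypothesis carries the
    factor [j] because at j = 0 the truncated predecessor turns y^(j-1) into 1. *)
Lemma shift_identity (R : comNzRingType) (xi xS yj yp y s w : R) (n j : nat) :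
  y * yp *+ j = yj *+ j ->
  y * (xi * yj * s *+ n + xS * yp * w *+ j) - w *+ j * (xS * yj) =
  s * (xi * (y * yj)) *+ n.
Proof.
move=> h; rewrite (_ : y * _ = s * (xi * (y * yj)) *+ n + xS * w * (y * yp *+ j)).
  by rewrite h; ring.
by ring.
Qed.

Section GenericKernel.
Variables (K : fieldType) (m : nat) (q : 'I_m -> {mpoly K[m]}).
Hypothesis hq : forall i, q i \is 2.-homog.
Hypothesis reg : forall (i : 'I_m) (p : {mpoly K[m]}),
  in_ideal_prefix q i (p * q i) -> in_ideal_prefix q i p.
Hypothesis char0 : [pchar K] =i pred0.
Variables (x y : 'rV[K]_m) (W : 'M[K]_m).
Local Notation X := (rowform x).
Local Notation Y := (rowform y).
Local Notation In := (in_ideal q).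
Hypothesis y_neq0 : y != 0.
(** The product rule for the derivative in a_s: row [s] of [W] is D_s y, and D_s x is ['X_s]. A
    saturated predecessor is harmless since its multiplicity is 0. *)
Hypothesis deriv : forall i j s, In (X ^+ i * Y ^+ j) ->
  In (X ^+ i.-1 * Y ^+ j * 'X_s *+ i + X ^+ i * Y ^+ j.-1 * rowform (row s W) *+ j).

Let T := (y + W)%MS.

(** The directions v whose derivative D_v y = v W lies in the row space of [B]. *)
Definition preimage_mx r (B : 'M[K]_(r, m)) := kermx (W *m cokermx B).
Let U := preimage_mx y.

Lemma sub_preimage r (B : 'M[K]_(r, m)) (v : 'rV_m) :
  (v <= preimage_mx B)%MS -> (v *m W <= B)%MS.
Proof. by rewrite sub_kermx mulmxA submxE. Qed.

(** The map sending v to D_v y modulo B has this preimage as kernel, and its image lies in T/B. *)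
Lemma rank_preimage r (B : 'M[K]_(r, m)) :
  (B <= T)%MS -> (m + \rank B <= \rank (preimage_mx B) + \rank T)%N.
Proof.
move=> sBT; rewrite mxrank_ker.
have := mxrank_mul_ker T (cokermx B).
have : (\rank B <= \rank (T :&: kermx (cokermx B)))%N.
  by apply: mxrankS; rewrite sub_capmx sBT sub_kermx mulmx_coker eqxx.
have : (\rank (W *m cokermx B) <= \rank (T *m cokermx B))%N.
  by apply: mxrankS; apply: submxMr; apply: addsmxSr.
by have := rank_leq_row (W *m cokermx B); lia.
Qed.

Lemma in_ideal_mulrn p n : In (p *+ n.+1) -> In p.
Proof.
rewrite -scaler_nat => /(ideal_prefixZ (n.+1%:R)^-1).
rewrite scalerA mulVf ?scale1r //.
by rewrite ((pcharf0P K).1 char0).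
Qed.

Lemma deriv_dir i j (v : 'rV[K]_m) : In (X ^+ i * Y ^+ j) ->
  In (X ^+ i.-1 * Y ^+ j * rowform v *+ i +
      X ^+ i * Y ^+ j.-1 * rowform (v *m W) *+ j).
Proof.
move=> h; have Ev : rowform v = \sum_s v 0 s *: 'X_s by [].
have EvW : rowform (v *m W) = \sum_s v 0 s *: rowform (row s W).
  rewrite mulmx_sum_row raddf_sum; apply: eq_bigr => s _.
  exact: linearZ.
rewrite Ev EvW !mulr_sumr -!sumrMnl -big_split /=.
apply: ideal_prefix_sum => s.
by rewrite -!scalerAr !scalerMnr -scalerDr; apply/ideal_prefixZ/deriv.
Qed.

(** Differentiate x^(i+1) y^j along v: the term containing D_v y vanishes by the hypothesis on B,
    and i+1 is invertible. *)
Lemma preimage_annihilates r (B : 'M[K]_(r, m)) i j :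
  In (X ^+ i.+1 * Y ^+ j) -> annihilates q B (X ^+ i.+1 * Y ^+ j.-1) ->
  annihilates q (preimage_mx B) (X ^+ i * Y ^+ j).
Proof.
move=> h hB v /sub_preimage/hB hv; apply: (@in_ideal_mulrn _ i).
have hv' : In (X ^+ i.+1 * Y ^+ j.-1 * rowform (v *m W) *+ j).
  by rewrite -scaler_nat; apply: ideal_prefixZ; rewrite mulrC.
have := ideal_prefixB (deriv_dir v h) hv'.
by rewrite addrK mulrC.
Qed.

Lemma y_annihilates p : In (Y * p) -> annihilates q y p.
Proof.
move=> h u /sub_rVP[c ->]; rewrite linearZ -scalerAl.
exact: ideal_prefixZ.
Qed.

Lemma tangent_annihilates j : In (Y ^+ j.+1) -> annihilates q T (Y ^+ j).
Proof.
move=> h; apply: annihilatesD; first by apply: y_annihilates; rewrite -exprS.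
apply: annihilates_rows => s; apply: (@in_ideal_mulrn _ j).
have := @deriv 0 j.+1 s; rewrite !expr0 !mul1r mulr0n add0r.
by rewrite [rowform _ * _]mulrC; apply.
Qed.

Lemma form_not_in : ~ In Y.
Proof.
move=> /(in_ideal_msize hq (msize_homog (rowform_homog y)))/eqP.
by rewrite rowform_eq0 (negPf y_neq0).
Qed.

Lemma expY_homog j : Y ^+ j \is j.-homog.
Proof. by have := dhomogMn j (rowform_homog y); rewrite mul1n. Qed.

Lemma XY_homog i j : X ^+ i * Y ^+ j \is (i + j).-homog.
Proof.
apply: dhomogM (expY_homog j).
by have := dhomogMn i (rowform_homog x); rewrite mul1n.
Qed.

(** T kills y^j. Were its rank above j, y^j would vanish too, and descent would reach y itself,
    which is nonzero. *)
Lemma rank_tangent j : In (Y ^+ j.+1) -> (\rank T <= j)%N.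
Proof.
elim: j => [|j IH] h; first by case: form_not_in; rewrite -[Y]expr1.
rewrite leqNgt; apply/negP => ltj.
have /IH : In (Y ^+ j.+1).
  exact: (annihilator_rank hq reg (expY_homog j.+1) (tangent_annihilates h) ltj).
by move=> /leq_trans/(_ (leqnSn _)); rewrite leqNgt ltj.
Qed.

(** Differentiating in each a_s and multiplying by y shows that all m variables kill x^i y^(j+1);
    its degree is below m, so [annihilator_rank] applies. *)
Lemma monomial_shift i j : (i + j.+1 < m)%N ->
  In (X ^+ i.+1 * Y ^+ j) -> In (X ^+ i * Y ^+ j.+1).
Proof.
move=> ltm h.
apply: (annihilator_rank hq reg (XY_homog i j.+1) (A := 1%:M)); last by rewrite mxrank1.
apply: annihilates_rows => s; rewrite row1 rowform_delta.
apply: (@in_ideal_mulrn _ i).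
have := ideal_prefixMl Y (deriv s h).
have := ideal_prefixMl (rowform (row s W) *+ j) h.
set w := rowform (row s W) => h1 h2.
have EY : Y * Y ^+ j.-1 *+ j = Y ^+ j *+ j.
  by case: (j) => [|j'] /=; rewrite ?mulr0n // -exprS.
have := ideal_prefixB h2 h1; rewrite (shift_identity _ _ _ _ _ EY).
by rewrite -exprS.
Qed.

(** * The first exponent k+1 at which a kernel appears *)

Section Step.
Variable k : nat.
Hypotheses (hk : (k < 4)%N) (hm : (k.+3 <= m)%N).
Hypothesis kernel : In (X ^+ k.+1 * Y).
Hypothesis nkernel : ~ In (X ^+ k * Y).

Lemma monomials_in i : (i <= k.+1)%N -> In (X ^+ i * Y ^+ (k.+2 - i)).
Proof.
(* Descending induction from i = k+1, where the claim is [kernel]. *)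
move=> /subKn <-; elim: (k.+1 - i)%N (leq_subr i k.+1) => [|j IH] lej.
  by rewrite subn0 subSnn expr1.
have E : (k.+2 - (k.+1 - j) = j.+1)%N by lia.
have E' : (k.+2 - (k.+1 - j.+1) = j.+2)%N by lia.
have := IH (ltnW lej); rewrite E E' (_ : k.+1 - j = (k.+1 - j.+1).+1)%N; last by lia.
by apply: monomial_shift; lia.
Qed.

(** One degree below the vanishing monomials of [monomials_in]; [Z k] is x^k y, which is nonzero by
    [nkernel]. *)
Local Notation Z i := (X ^+ i * Y ^+ (k.+1 - i)).

Lemma Z_homog i : (i <= k.+1)%N -> Z i \is k.+1.-homog.
Proof. by move=> le; have := XY_homog i (k.+1 - i); rewrite subnKC. Qed.

Lemma y_annihilates_Z i : (i <= k.+1)%N -> annihilates q y (Z i).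
Proof.
move=> le; apply: y_annihilates; have := monomials_in le.
by rewrite subSn // exprS mulrCA.
Qed.

Lemma preimage_annihilates_Z r (B : 'M[K]_(r, m)) i : (i <= k)%N ->
  annihilates q B (Z i.+1) -> annihilates q (preimage_mx B) (Z i).
Proof.
move=> le hB; have E : (k.+2 - i.+1 = k.+1 - i)%N by lia.
apply: preimage_annihilates; first by have := monomials_in (i := i.+1) le; rewrite E.
by rewrite (_ : (k.+1 - i).-1 = k.+1 - i.+1)%N //; lia.
Qed.

Lemma U_annihilates_Z i : (i <= k)%N -> annihilates q U (Z i).
Proof. by move=> le; apply/preimage_annihilates_Z/y_annihilates_Z. Qed.

Lemma rank_U : (m.+1 <= \rank U + \rank T)%N.
Proof.
have := rank_preimage (addsmxSl y W : (y <= T)%MS).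
by rewrite rank_rV y_neq0 addn1.
Qed.

Lemma rank_U_le : (\rank U <= k.+1)%N.
Proof.
rewrite leqNgt; apply/negP => lt; apply: nkernel.
have := annihilator_rank hq reg (Z_homog (leqnSn k)) (U_annihilates_Z (leqnn k)) lt.
by rewrite subSnn expr1.
Qed.

Lemma rank_T_le : (\rank T <= k.+1)%N.
Proof.
by apply: rank_tangent; have := monomials_in (leq0n _); rewrite mul1r subn0.
Qed.

(** If equality held, y^(k+1) would be nonzero and killed by T + U, forcing U into T. Then B = U + y
    kills [Z 1], so the preimage of B kills y^(k+1), and that preimage is too large. *)
Lemma rank_T_neq : \rank T != k.+1.
Proof.
apply/eqP => rT.
have nZ0 : ~ In (Y ^+ k.+1) by move=> /rank_tangent; rewrite rT ltnn.
have Z0 : In (Y ^+ k.+2) by have := monomials_in (leq0n _); rewrite mul1r subn0.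
have Z0E : Z 0 = Y ^+ k.+1 by rewrite mul1r subn0.
have sUT : (U <= T)%MS.
  have hTU : annihilates q (T + U)%MS (Y ^+ k.+1).
    apply: annihilatesD (tangent_annihilates Z0) _.
    by rewrite -Z0E; apply: U_annihilates_Z.
  have le : (\rank (T + U) <= k.+1)%N.
    rewrite leqNgt; apply/negP => lt; apply: nZ0.
    exact: (annihilator_rank hq reg (expY_homog _) hTU lt).
  have : (T + U <= T)%MS by rewrite -(geq_leqif (mxrank_leqif_sup (addsmxSl T U))) rT.
  exact: submx_trans (addsmxSr _ _).
have k_gt0 : (0 < k)%N by have := rank_U; have := rank_U_le; lia.
pose B := (U + y)%MS.
have sBT : (B <= T)%MS by rewrite addsmx_sub sUT addsmxSl.
have : annihilates q (preimage_mx B) (Z 0).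
  apply: preimage_annihilates_Z => //.
  by apply: annihilatesD; [apply: U_annihilates_Z | apply: y_annihilates_Z].
move=> /(annihilator_rank hq reg (Z_homog (leq0n _))) hB.
have leB : (\rank (preimage_mx B) <= k.+1)%N.
  by rewrite leqNgt; apply/negP => /hB; rewrite Z0E.
(* Since rank B >= rank U >= m - k, this gives 2m <= 3k + 2, impossible for m >= k + 3 and k <=
   3. *)
have := rank_preimage sBT; have := mxrankS (addsmxSl U y : (U <= B)%MS).
by have := rank_U; lia.
Qed.

(** Either T + U is large enough to force vanishing, or T lies in U and so kills [Z i.+1]. In the
    latter case every direction lies in the preimage of T, so all linear forms kill [Z i]. *)
Lemma tangent_kills_Z i : (i < k)%N -> (k.+1 <= \rank U)%N -> (k.+1 < m)%N ->
  annihilates q T (Z i) -> In (Z i).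
Proof.
move=> lti rU ltm hT.
have hTU := annihilatesD hT (U_annihilates_Z (ltnW lti)).
have hZ := Z_homog (leq_trans (ltnW lti) (leqnSn k)).
have [le|] := leqP (\rank (T + U)) k.+1; last exact: (annihilator_rank hq reg hZ hTU).
have sTU : (T <= U)%MS.
  have : (T + U <= U)%MS.
    by rewrite -(geq_leqif (mxrank_leqif_sup (addsmxSr T U))) (leq_trans le).
  exact: submx_trans (addsmxSl _ _).
have hT1 : annihilates q T (Z i.+1) := annihilates_sub sTU (U_annihilates_Z lti).
apply: (annihilator_rank hq reg hZ (preimage_annihilates_Z (ltnW lti) hT1)).
by have := rank_preimage (submx_refl T); lia.
Qed.

Lemma kernel_contradiction : False.
Proof.
have rT := rank_T_le; have nrT := rank_T_neq; have rU := rank_U; have rUk := rank_U_le.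
have Z0 : In (Y ^+ k.+2) by have := monomials_in (leq0n _); rewrite mul1r subn0.
(* From rank T <= k, rank U <= k+1 and rank T + rank U >= m+1 >= k+4, only this case survives. *)
have [k3 rT3 rU4 m6] : [/\ k = 3%N, \rank T = 3%N,
    (4 <= \rank U)%N & m = 6%N] by split; lia.
have nY3 : ~ In (Y ^+ 3) by move=> /rank_tangent; rewrite rT3.
have kills i : (i < 3)%N -> annihilates q T (X ^+ i * Y ^+ (4 - i)) ->
    In (X ^+ i * Y ^+ (4 - i)).
  have := @tangent_kills_Z i; rewrite k3 => hk3 lti; apply: hk3 => //.
  by rewrite m6.
(* T kills y^4, hence y^4 = 0; then T kills y^3 and so x y^3, hence x y^3 = 0. Differentiating this
   last relation makes U, of rank at least 4, kill the cubic y^3. *)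
have Y4 : In (Y ^+ 4).
  have := kills 0 isT; rewrite mul1r; apply.
  by apply: tangent_annihilates; rewrite -{1}k3.
have XY3 : In (X ^+ 1 * Y ^+ 3).
  apply: kills => // u /(tangent_annihilates Y4) hu.
  by rewrite mulrCA; apply: ideal_prefixMl.
apply: nY3.
have : annihilates q U (X ^+ 0 * Y ^+ 3).
  apply: (preimage_annihilates XY3); apply: y_annihilates.
  by rewrite mulrCA -exprS.
move=> /(annihilator_rank hq reg (XY_homog 0 3))/(_ rU4).
by rewrite mul1r.
Qed.

End Step.

Theorem generic_power_injective k : (k <= 4)%N -> (k.+2 <= m)%N -> ~ In (X ^+ k * Y).
Proof.
elim: k => [|k IH] lek ltm; first by rewrite mul1r; apply: form_not_in.
by move=> h; apply: (kernel_contradiction lek ltm h); apply: IH; apply: ltnW.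
Qed.

End GenericKernel.

(** * The generic point *)

Section CoefficientMaps.
Variables (A B : comNzRingType) (m : nat).

Lemma map_mpoly_inj (f : {rmorphism A -> B}) :
  injective f -> injective (map_mpoly f : {mpoly A[m]} -> {mpoly B[m]}).
Proof.
move=> inj p r E; apply/mpolyP => t; apply: inj.
by rewrite -!mcoeff_map_mpoly E.
Qed.

Lemma map_mpoly_semilinear (f : {additive A -> B}) (g : {rmorphism B -> A})
    (c : {mpoly A[m]}) (p : {mpoly B[m]}) :
  (forall a b, f (a * g b) = f a * b) ->
  map_mpoly f (c * map_mpoly g p) = map_mpoly f c * p.
Proof.
move=> fg; apply/mpolyP => t; rewrite mcoeff_map_mpoly !mcoeffM raddf_sum.
by apply: eq_bigr => k _; rewrite /= !mcoeff_map_mpoly fg.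
Qed.

Lemma map_mpoly_leibniz (f : {additive A -> A}) (p r : {mpoly A[m]}) :
  (forall a b, f (a * b) = f a * b + a * f b) ->
  map_mpoly f (p * r) = map_mpoly f p * r + p * map_mpoly f r.
Proof.
move=> fM; apply/mpolyP => t; rewrite mcoeffD mcoeff_map_mpoly !mcoeffM raddf_sum.
by rewrite -big_split; apply: eq_bigr => k _; rewrite /= fM !mcoeff_map_mpoly.
Qed.

End CoefficientMaps.

Section GenericPoint.
Variables (K : fieldType) (m : nat) (L : fieldType).
Local Notation P := {mpoly K[m]}.
(** [P] is the ring K[a] of coefficients of the generic form. Its fraction field L enters only
    through the two properties below. *)
Variable tf : {rmorphism P -> L}.
Hypothesis tf_inj : injective tf.
Hypothesis tf_frac : forall z : L, exists g p : P, g != 0 /\ tf g * z = tf p.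

Local Notation mapL := (map_mpoly tf).
Definition const_mpoly (p : {mpoly K[m]}) : {mpoly P[m]} := map_mpoly (@mpolyC m K) p.

Lemma const_mpolyM : {morph const_mpoly : p r / p * r}.
Proof. exact: (rmorphM (map_mpoly (@mpolyC m K))). Qed.

Lemma const_mpoly_sum (I : Type) (s : seq I) (Q : pred I) (F : I -> {mpoly K[m]}) :
  const_mpoly (\sum_(i <- s | Q i) F i) = \sum_(i <- s | Q i) const_mpoly (F i).
Proof. exact: (raddf_sum (map_mpoly (@mpolyC m K))). Qed.

Lemma tf_neq0 g : g != 0 -> tf g != 0.
Proof. by rewrite -(rmorph0 tf) (inj_eq tf_inj). Qed.

Lemma clear_denominators (p : {mpoly L[m]}) :
  exists (g : P) (p' : {mpoly P[m]}), g != 0 /\ tf g *: p = mapL p'.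
Proof.
elim/mpolyind: p => [|c t p _ _ [g2 [p' [g20 Ep]]]].
  by exists 1, 0; rewrite oner_neq0 scaler0 raddf0.
have [g1 [c' [g10 Ec]]] := tf_frac c.
exists (g1 * g2), ((g2 * c') *: 'X_[t] + g1 *: p'); split; first by rewrite mulf_neq0.
rewrite [mapL _]raddfD /= !map_mpolyZ map_mpolyX -Ep !rmorphM -Ec scalerDr !scalerA.
by congr (_ *: _ + _); ring.
Qed.

Lemma clear_denominators_fin (I : finType) (p : I -> {mpoly L[m]}) :
  exists (g : P) (p' : I -> {mpoly P[m]}),
    g != 0 /\ forall i, tf g *: p i = mapL (p' i).
Proof.
have /fin_all_exists2[g g0 hg] (i : I) : exists2 g : P, g != 0 &
    exists p' : {mpoly P[m]}, tf g *: p i = mapL p'.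
  by have [g [p' [g0 E]]] := clear_denominators (p i); exists g => //; exists p'.
have [p' Ep] := fin_all_exists hg.
exists (\prod_i g i), (fun i => (\prod_(j | j != i) g j) *: p' i); split.
  by apply/prodf_neq0 => i _; apply: g0.
move=> i; rewrite map_mpolyZ -Ep scalerA (bigD1 i) //= rmorphM; congr (_ *: _); ring.
Qed.

Section Ideal.
Variables (N : nat) (q : 'I_N -> {mpoly K[m]}).
Let qP i := const_mpoly (q i).
Definition generic_quadrics i := mapL (qP i).
Local Notation qL := generic_quadrics.

Lemma coef_const t c p :
  map_mpoly (mcoeff t) (c * const_mpoly p) = map_mpoly (mcoeff t) c * p.
Proof.
by apply: map_mpoly_semilinear => a b; rewrite [a * _]mulrC /= mcoeffCM mulrC.
Qed.

(** K[a][x] is free over K[x] on the monomials in a; together with [coef_const] this reduces ideal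
    membership to K. *)
Lemma coef_sum (p : {mpoly P[m]}) : exists k,
  p = \sum_(t : 'X_{1..m < k})
        ('X_[t])%:MP * const_mpoly (map_mpoly (mcoeff t) p).
Proof.
exists (\max_(u <- msupp p) msize p@_u)%N; apply/mpolyP => u; rewrite raddf_sum /=.
have le : (msize p@_u <= \max_(u <- msupp p) msize p@_u)%N.
  have [up|/memN_msupp_eq0->] := boolP (u \in msupp p); last by rewrite mmeasure0.
  exact: leq_bigmax_seq.
rewrite {1}[p@_u](mpolywE le); apply: eq_bigr => t _.
by rewrite mcoeffCM !mcoeff_map_mpoly mulrC mul_mpolyC.
Qed.

(** Flat base change by hand: clear denominators, split the relation along monomials in a, use
    regularity over K for each, and reassemble. *)
Lemma generic_regular :
  (forall (i : 'I_N) (p : {mpoly K[m]}),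
     in_ideal_prefix q i (p * q i) -> in_ideal_prefix q i p) ->
  forall (i : 'I_N) (p : {mpoly L[m]}),
     in_ideal_prefix qL i (p * qL i) -> in_ideal_prefix qL i p.
Proof.
move=> reg i p [c Ec].
have [g1 [p' [g10 Ep]]] := clear_denominators p.
have [g2 [c' [g20 Ec']]] := clear_denominators_fin c.
have E : g2 *: p' * qP i = \sum_(j < N | (j < i)%N) g1 *: c' j * qP j.
  apply: (map_mpoly_inj tf_inj); rewrite rmorphM /= map_mpolyZ -Ep [RHS]raddf_sum /=.
  rewrite -/(qL i) -!scalerAl Ec !scaler_sumr; apply: eq_bigr => j _.
  by rewrite rmorphM /= map_mpolyZ -Ec' !scalerA -scalerAl mulrC.
have hp' t : in_ideal_prefix q i (map_mpoly (mcoeff t) (g2 *: p')).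
  apply: reg; rewrite -coef_const E; exists (fun j => map_mpoly (mcoeff t) (g1 *: c' j)).
  by rewrite raddf_sum; apply: eq_bigr => j _; apply: coef_const.
have hL : in_ideal_prefix qL i (mapL (g2 *: p')).
  have [k ->] := coef_sum (g2 *: p'); rewrite raddf_sum; apply: ideal_prefix_sum => t.
  rewrite /= rmorphM; apply: ideal_prefixMl; have [d ->] := hp' t.
  exists (fun j => mapL (const_mpoly (d j))).
  rewrite const_mpoly_sum [LHS]raddf_sum; apply: eq_bigr => j _.
  by rewrite const_mpolyM; exact: rmorphM.
rewrite map_mpolyZ -Ep scalerA in hL.
have := ideal_prefixZ (tf g2 * tf g1)^-1 hL.
by rewrite scalerA mulVf ?scale1r // mulf_neq0 // tf_neq0.
Qed.

Lemma generic_quadrics_homog :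
  (forall i, q i \is 2.-homog) -> forall i, qL i \is 2.-homog.
Proof.
move=> hq i; apply/dhomogP => t; rewrite mcoeff_msupp !mcoeff_map_mpoly.
by apply: contraNeq => ne; rewrite (dhomog_nemf_coeff (hq i) ne) !raddf0 eqxx.
Qed.

Definition pderiv (s : 'I_m) : {mpoly P[m]} -> {mpoly P[m]} := map_mpoly (mderiv s).

Lemma pderivM s p r : pderiv s (p * r) = pderiv s p * r + p * pderiv s r.
Proof. by apply: map_mpoly_leibniz => a b; apply: mderivM. Qed.

Lemma pderiv_sum s (I : Type) (r : seq I) (Q : pred I) (F : I -> {mpoly P[m]}) :
  pderiv s (\sum_(i <- r | Q i) F i) = \sum_(i <- r | Q i) pderiv s (F i).
Proof. exact: (raddf_sum (map_mpoly (mderiv s))). Qed.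

Lemma pderivX s p n : pderiv s (p ^+ n) = p ^+ n.-1 * pderiv s p *+ n.
Proof.
elim: n => [|n IH].
  rewrite expr0 mulr0n /pderiv -mpolyC1 map_mpolyC /= -[1]/(1%:MP) mderivC.
  exact: mpolyC0.
rewrite exprS pderivM IH /= mulrS; congr (_ + _); first by rewrite mulrC.
by case: n {IH} => [|n]; rewrite ?mulr0n ?mulr0 //= mulrnAr mulrA -exprS.
Qed.

Lemma pderiv_const s p : pderiv s (const_mpoly p) = 0.
Proof. by apply/mpolyP => t; rewrite !mcoeff_map_mpoly mcoeff0; apply: mderivC. Qed.

(** The generators are constant in a, so differentiating a relation g G = sum c_j q_j only
    differentiates the c_j. The product rule leaves g D_s G in the ideal, and g is invertible in
    L. *)
Lemma generic_deriv s (G : {mpoly P[m]}) :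
  in_ideal qL (mapL G) -> in_ideal qL (mapL (pderiv s G)).
Proof.
move=> hG; have [c Ec] := hG; have [g [c' [g0 Ec']]] := clear_denominators_fin c.
have E : g%:MP * G = \sum_(j < N) c' j * qP j.
  apply: (map_mpoly_inj tf_inj); rewrite rmorphM /= map_mpolyC mul_mpolyC Ec.
  rewrite [RHS]raddf_sum /= scaler_sumr; apply: eq_big => [j|j _]; first by rewrite ltn_ord.
  by rewrite rmorphM /= -Ec' -scalerAl.
have := congr1 (fun H => mapL (pderiv s H)) E.
rewrite /= pderivM rmorphD !rmorphM /= map_mpolyC mul_mpolyC => E'.
have h : in_ideal qL (tf g *: mapL (pderiv s G)).
  rewrite -[_ *: _](addKr (mapL (pderiv s g%:MP) * mapL G)) E'.
  apply: ideal_prefixD; first by apply/ideal_prefixN/ideal_prefixMl.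
  rewrite pderiv_sum [mapL _]raddf_sum; apply: ideal_prefix_sum => j /=.
  rewrite pderivM pderiv_const mulr0 addr0 rmorphM.
  by apply: ideal_prefixMl; apply: (in_ideal_gen qL j).
have := ideal_prefixZ (tf g)^-1 h.
by rewrite scalerA mulVf ?scale1r // tf_neq0.
Qed.

End Ideal.

Lemma generic_injective (q : 'I_m -> {mpoly K[m]}) k (v : 'rV[L]_m) :
  [pchar K] =i pred0 -> (forall i, q i \is 2.-homog) ->
  (forall (i : 'I_m) (p : {mpoly K[m]}),
     in_ideal_prefix q i (p * q i) -> in_ideal_prefix q i p) ->
  (k <= 4)%N -> (k.+2 <= m)%N ->
  in_ideal (generic_quadrics q) (rowform (\row_i tf 'X_i) ^+ k * rowform v) -> v = 0.
Proof.
move=> char0 hq reg lek ltm hv; apply/eqP; apply: contraPT hv => v0.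
(* Rescaling v by a common denominator makes its coordinates polynomials in a, which can be
   differentiated. *)
have [g [y [g0 Ey]]] : exists g (y : 'I_m -> P),
    g != 0 /\ forall i, tf g * v 0 i = tf (y i).
  have [g [p' [g0 Ep]]] := clear_denominators (rowform v).
  exists g, (fun i => p'@_U_(i)); split=> // i.
  by rewrite -mcoeff_map_mpoly -Ep mcoeffZ mcoeff_linform.
pose lin (z : 'I_m -> P) : {mpoly P[m]} := \sum_i z i *: 'X_i.
have lin_map z : mapL (lin z) = rowform (\row_i tf (z i)).
  rewrite /lin [LHS]raddf_sum; apply: eq_bigr => i _.
  by rewrite mxE /= map_mpolyZ map_mpolyX.
have lin_deriv s z : pderiv s (lin z) = lin (fun i => (z i)^`M(s)).
  rewrite pderiv_sum; apply: eq_bigr => i _; apply/mpolyP => t.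
  by rewrite mcoeff_map_mpoly !mcoeffZ !mcoeffX !mulr_natr raddfMn.
pose w : 'rV[L]_m := \row_i tf (y i).
have Ew : w = tf g *: v by apply/rowP => i; rewrite !mxE Ey.
pose W : 'M[L]_m := \matrix_(s, i) tf (y i)^`M(s).
move=> hv.
have hw : in_ideal (generic_quadrics q) (rowform (\row_i tf 'X_i) ^+ k * rowform w).
  by rewrite Ew linearZ -scalerAr; apply: ideal_prefixZ.
have charL : [pchar L] =i pred0.
  by move=> p; rewrite -(char0 p) -(fmorph_pchar (tf \o @mpolyC m K)).
have w0 : w != 0 by rewrite Ew scaler_eq0 negb_or tf_neq0.
apply: (generic_power_injective (generic_quadrics_homog hq) (generic_regular reg) charL
          w0 (W := W) _ lek ltm hw) => i j s.
have EG i' j' : rowform (\row_l tf 'X_l) ^+ i' * rowform w ^+ j' =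
    mapL (lin (fun l => 'X_l) ^+ i' * lin y ^+ j').
  by rewrite rmorphM !rmorphXn /= !lin_map.
rewrite !EG => /(generic_deriv s).
rewrite pderivM !pderivX !lin_deriv.
have -> : lin (fun i => ('X_i : P)^`M(s)) = 'X_s.
  rewrite /lin (bigD1 s) //= big1 ?addr0 => [|l ne].
    by rewrite mderivX mnm1E eqxx -{1}[U_(s)%MM]add0m addmK mpolyX0 !scale1r.
  by rewrite mderivX mnm1E (negPf ne) !scale0r.
have -> : row s W = \row_i tf (y i)^`M(s) by apply/rowP => l; rewrite !mxE.
rewrite -lin_map -(map_mpolyX tf) -!rmorphM -!rmorphMn -rmorphD.
congr (in_ideal _ (mapL _)); rewrite mulrnAl mulrnAr mulrA; congr (_ + _).
by rewrite mulrAC.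
Qed.

End GenericPoint.

(** * Specialization *)

Section CoefficientRows.
Variable m D : nat.
Local Notation M := #|{: 'X_{1..m < D}}|.

Definition coefrow (R : nzRingType) (p : {mpoly R[m]}) : 'rV[R]_M :=
  \row_j p@_(enum_val j : 'X_{1..m < D}).

Fact coefrow_is_linear (R : nzRingType) : linear (@coefrow R).
Proof. by move=> c p r; apply/rowP => j; rewrite !mxE mcoeffD mcoeffZ. Qed.
HB.instance Definition _ (R : nzRingType) :=
  GRing.isLinear.Build R {mpoly R[m]} 'rV[R]_M _ (@coefrow R) (@coefrow_is_linear R).

Lemma coefrow_sum (R : nzRingType) (I : Type) (s : seq I) (Q : pred I)
    (F : I -> {mpoly R[m]}) :
  coefrow (\sum_(i <- s | Q i) F i) = \sum_(i <- s | Q i) coefrow (F i).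
Proof. exact: (raddf_sum (@coefrow R)). Qed.

Lemma coefrow_inj (R : nzRingType) (p r : {mpoly R[m]}) :
  (msize p <= D)%N -> (msize r <= D)%N -> coefrow p = coefrow r -> p = r.
Proof.
move=> sp sr E; apply/mpolyP => t; have [ltD|leD] := ltnP (mdeg t) D.
  have := congr1 (fun v : 'rV_M => v 0 (enum_rank (BMultinom ltD))) E.
  by rewrite !mxE enum_rankK.
by rewrite !memN_msupp_eq0 // msize_mdeg_ge // (leq_trans _ leD).
Qed.

End CoefficientRows.

Section MembershipMatrix.
Variables (m k : nat).
Local Notation Mon := 'X_{1..m < k}.

(** The row space is the part of the ideal in degrees at most k+1, so membership there becomes
    linear algebra compatible with [map_mx]. *)
Definition membership_mx (R : comNzRingType) (q : 'I_m -> {mpoly R[m]}) :=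
  \matrix_(i < #|{: Mon * 'I_m}|)
    coefrow k.+2 ('X_[(enum_val i).1] * q (enum_val i).2).

Variables (F : fieldType) (q : 'I_m -> {mpoly F[m]}).
Hypothesis hq : forall i, q i \is 2.-homog.

Lemma msize_trunc d (p : {mpoly F[m]}) : (msize (trunc d p) <= d)%N.
Proof.
apply: leq_trans (msize_sum _ _ _) _; apply/bigmax_leqP => i _.
exact: leq_trans (msize_homog (pihomogP _ _ _)) (ltn_ord i).
Qed.

Lemma membership_row (p : {mpoly F[m]}) :
  (msize p <= k.+2)%N -> in_ideal q p -> (coefrow k.+2 p <= membership_mx q)%MS.
Proof.
move=> sp [c Ep]; rewrite -(trunc_small sp) Ep [trunc _ _]raddf_sum coefrow_sum /=.
apply: summx_sub => j _; rewrite mulrC (truncM _ _ (hq j)) !subSS subn0.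
rewrite (mpolywE (msize_trunc k (c j))) mulr_sumr coefrow_sum.
apply: summx_sub => u _; rewrite -scalerAr linearZ; apply: scalemx_sub => /=.
rewrite mulrC -[u]/(u, j).1 -{2}[j]/(u, j).2 -(enum_rankK (u, j)).
rewrite (_ : coefrow _ _ = row (enum_rank (u, j)) (membership_mx q)) ?row_sub //.
by apply/rowP => l; rewrite !mxE.
Qed.

Lemma row_membership (p : {mpoly F[m]}) :
  (msize p <= k.+2)%N -> (coefrow k.+2 p <= membership_mx q)%MS -> in_ideal q p.
Proof.
move=> sp /submxP[w Ew].
pose r := \sum_i w 0 i *: ('X_[(enum_val i).1 : Mon] * q (enum_val i).2).
have Er : in_ideal q r.
  apply: ideal_prefix_sum => i; apply/ideal_prefixZ/ideal_prefixMl.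
  exact: in_ideal_gen.
suff -> : p = r by [].
apply: (@coefrow_inj m k.+2) => //.
  apply: leq_trans (msize_sum _ _ _) _; apply/bigmax_leqP => i _.
  apply: leq_trans (msizeZ_le _ _) _.
  have h : 'X_[(enum_val i).1 : Mon] \is (mdeg (enum_val i).1).-homog.
    by move=> R; rewrite dhomogX.
  apply: leq_trans (msize_homog (dhomogM (h F) (hq _))) _.
  by rewrite addn2 !ltnS; apply: bmdeg.
rewrite Ew mulmx_sum_row coefrow_sum; apply: eq_bigr => i _.
rewrite linearZ /=; congr (_ *: _); by apply/rowP => l; rewrite !mxE.
Qed.

End MembershipMatrix.

Lemma membership_map m k (F F' : comNzRingType) (f : {rmorphism F -> F'})
    (q : 'I_m -> {mpoly F[m]}) :
  map_mx f (membership_mx k q) = membership_mx k (fun i => map_mpoly f (q i)).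
Proof.
by apply/matrixP => i l; rewrite !mxE -mcoeff_map_mpoly rmorphM /= map_mpolyX.
Qed.

Definition power_mx (R : comNzRingType) m k (x : {mpoly R[m]}) :=
  \matrix_(i < m) coefrow k.+2 (x ^+ k * 'X_i).

Lemma power_mx_map (R R' : comNzRingType) m k (f : {rmorphism R -> R'})
    (x : {mpoly R[m]}) :
  map_mx f (power_mx k x) = power_mx k (map_mpoly f x).
Proof.
apply/matrixP => i l; rewrite !mxE -mcoeff_map_mpoly rmorphM rmorphXn.
by rewrite /= map_mpolyX.
Qed.

Lemma mul_power_mx (F : fieldType) m k (x : {mpoly F[m]}) (u : 'rV[F]_m) :
  u *m power_mx k x = coefrow k.+2 (x ^+ k * rowform u).
Proof.
rewrite mulmx_sum_row mulr_sumr coefrow_sum; apply: eq_bigr => i _.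
by rewrite rowK -scalerAr linearZ.
Qed.

Lemma linform_power_msize (F : fieldType) m k (a : 'I_m -> F) (l : {mpoly F[m]}) :
  l \is 1.-homog -> (msize (linform a ^+ k * l) <= k.+2)%N.
Proof.
move=> hl; apply: msize_homog; have := dhomogMn k (linform_homog a).
by rewrite mul1n => h; have := dhomogM h hl; rewrite addn1.
Qed.

Section Specialization.
Variables (K : fieldType) (m k : nat) (L : fieldType).
Local Notation P := {mpoly K[m]}.
Variable tf : {rmorphism P -> L}.
Hypothesis tf_inj : injective tf.
Hypothesis tf_frac : forall z : L, exists g p : P, g != 0 /\ tf g * z = tf p.
Variable q : 'I_m -> {mpoly K[m]}.
Hypothesis hq : forall i, q i \is 2.-homog.

Lemma clear_denominators_mx r s (B : 'M[L]_(r, s)) :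
  exists (g : P) (B' : 'M[P]_(r, s)), g != 0 /\ tf g *: B = map_mx tf B'.
Proof.
have [g [p' [g0 Ep]]] := clear_denominators_fin tf_frac
  (fun ij : 'I_r * 'I_s => (B ij.1 ij.2)%:MP : {mpoly L[m]}).
exists g, (\matrix_(i, j) (p' (i, j))@_0%MM); split=> //.
apply/matrixP => i j; rewrite !mxE -mcoeff_map_mpoly -Ep mcoeffZ mcoeffC.
by rewrite eqxx mulr1.
Qed.

(** Injectivity over L yields a right inverse of the matrix of x^k modulo the ideal. Clearing its
    denominators gives an identity A B' = g over K[a], and g is the required polynomial. *)
Lemma specialize_injective :
  (forall v : 'rV[L]_m,
    in_ideal (generic_quadrics tf q) (rowform (\row_i tf 'X_i) ^+ k * rowform v) -> v = 0) ->
  exists F : P, F != 0 /\ forall a : 'I_m -> K, F.@[a] != 0 ->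
    mult_pow_injective_R1 q (linform a) k.
Proof.
move=> inj; pose C := cokermx (membership_mx k q).
pose x : {mpoly P[m]} := \sum_i 'X_i *: 'X_i.
have mapx (B : fieldType) (f : {rmorphism P -> B}) :
    map_mpoly f x = linform (fun i => f 'X_i).
  by rewrite [LHS]raddf_sum; apply: eq_bigr => i _; rewrite /= map_mpolyZ map_mpolyX.
(* [C] has entries in K, as the quadrics do not involve a, so it tests membership both over L and
   after specialization. *)
pose A := power_mx k x *m map_mx (@mpolyC m K) C.
have mapA (B : fieldType) (f : {rmorphism P -> B}) :
    map_mx f A = power_mx k (linform (fun i => f 'X_i)) *m
                 map_mx f (map_mx (@mpolyC m K) C).
  by rewrite map_mxM power_mx_map mapx.
have mapC : map_mx tf (map_mx (@mpolyC m K) C)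
    = cokermx (membership_mx k (generic_quadrics tf q)).
  rewrite -map_mx_comp (map_cokermx (tf \o @mpolyC m K)) map_mx_comp.
  by rewrite !membership_map.
have xL : linform (fun i => tf 'X_i) = rowform (\row_i tf 'X_i).
  by apply: eq_bigr => i _; rewrite mxE.
have /row_freeP[B AB] : row_free (map_mx tf A).
  apply: inj_row_free => v; rewrite mapA mapC mulmxA mul_power_mx => /eqP.
  rewrite -submxE xL => hv; apply: inj.
  apply: (row_membership (generic_quadrics_homog _ hq)) hv.
  exact: linform_power_msize (rowform_homog v).
have [g [B' [g0 EB]]] := clear_denominators_mx B.
exists g; split=> // a ga0 l hl hxl.
have AB' : A *m B' = g%:M.
  have inj_mx r s : injective (fun M : 'M[P]_(r, s) => map_mx tf M).
    move=> M M' /matrixP E; apply/matrixP => i j; apply: tf_inj.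
    by have := E i j; rewrite !mxE.
  apply: inj_mx; rewrite map_mxM -EB -scalemxAr AB map_scalar_mx.
  by rewrite scalemx1.
suff -> : l = 0 by apply: ideal_prefix0.
rewrite (homog1_rowform hl); set u := \row_i _; apply/eqP; rewrite rowform_eq0.
have Eu : u *m power_mx k (linform a) *m C = 0.
  apply/eqP; rewrite mul_power_mx -(homog1_rowform hl) -submxE.
  exact: (membership_row hq (linform_power_msize k a hl) hxl).
(* Evaluating at a and multiplying by u gives g(a) u = 0. *)
have := congr1 (fun M => u *m map_mx (meval a) M) AB'.
rewrite /= map_mxM mapA map_scalar_mx mul_mx_scalar !mulmxA.
rewrite (_ : linform _ = linform a); last by apply: eq_bigr => i _; rewrite /= mevalXU.
rewrite -map_mx_comp (_ : map_mx _ C = C); last first.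
  by apply/matrixP => i j; rewrite mxE /= mevalC.
rewrite Eu mul0mx => /esym/eqP; rewrite scaler_eq0 => /orP[/eqP ga|//].
by rewrite ga eqxx in ga0.
Qed.

End Specialization.

Section FractionField.
Local Open Scope quotient_scope.
 Variable R : idomainType.
Lemma fraction_frac (z : {fraction R}) :
  exists g p : R, g != 0 /\ FracField.tofrac g * z = FracField.tofrac p.
Proof.
elim/quotW: z => x.
exists \d_x, \n_x; split; first exact: denom_ratioP.
unlock FracField.tofrac; rewrite -[LHS]FracField.pi_mul; apply/eqP.
rewrite FracField.equivf_def /FracField.mulf !numden_Ratio ?mul1r ?mulr1 ?oner_neq0 ?denom_ratioP //.
Qed.
End FractionField.

(* K algebraically closed of characteristic 0; S = K[x_0..x_n];
   q_0..q_n a regular sequence of homogeneous quadrics; R = S/(q).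
   Conclusion SLP_1(k): there is a nonempty Zariski-open set of x in R^1
   (containing the basic open set {F <> 0}, F a nonzero polynomial in the
   coordinates of x) on which x^k : R^1 -> R^{k+1} is injective. *)
Theorem mainTheorem16 (K : closedFieldType) (n k : nat)
  (q : 'I_n.+1 -> {mpoly K[n.+1]}) :
  [pchar K] =i pred0 ->
  (2 <= k <= 4)%N ->
  (k + 1 <= n)%N ->
  (forall i, q i \is 2.-homog) ->
  regular_sequence q ->
  exists F : {mpoly K[n.+1]}, F != 0 /\
    forall a : 'I_n.+1 -> K, F.@[a] != 0 ->
      mult_pow_injective_R1 q (linform a) k.
Proof.
move=> char0 /andP[_ lek] ltn hq [reg _].
have tf_inj : injective (@FracField.tofrac {mpoly K[n.+1]}).
  by move=> x y /eqP; rewrite tofrac_eq => /eqP.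
apply: (specialize_injective tf_inj (@fraction_frac _) hq) => v.
apply: (generic_injective tf_inj (@fraction_frac _)) => //.
by rewrite addn1 in ltn.
Qed.
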